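(* Let $P$ be a finite ordered set, let $M$ be the chopped lattice of the 1960 construction for $P$, and let $\mathbf{u} \le \mathbf{v}$ be compatible vectors of $M$. Let $\mathbf{s}$ be the unique sectional complement of $\mathbf u$ in $\mathbf v$ produced by the Algorithm (the output does not depend on the choices made in the Algorithm). Then $\mathbf{s}$ is the 1960 sectional complement, that is, $\mathbf{s} = \mathbf{s}_{1960}$.
   Context: **The chopped lattice $M$.** $P$ is a finite ordered set (the join-irreducible elements of a finite distributive lattice); $x \succ y$ means $x$ covers $y$ in $P$. For $p \succ q$ in $P$, let $N(p,q) = \{0, p_1, q_1, q_2, q, p(q)\}$ be the six-element lattice with covering relations $0 \prec q_1 \prec q$, $0 \prec q_2 \prec q$, $q \prec p(q)$, $0 \prec p_1 \prec p(q)$ (and no others). $M$ is the union of all $N(p,q)$, $p \succ q$ in $P$, where elements with the same name are identified ($0$ is common to all; the elements $p_1$, $p_2$, $p$, when present, depend only on $p$; the element $p(q)$ depends on the pair $(p,q)$). Set $a \le b$ in $M$ iff $a,b$ lie in some $N(p,q)$ and $a \le b$ there. Then $M$ is a finite meet-semilattice with $0$ in which the maximal elements are the $p(q)$ and the principal ideal generated by $p(q)$ is $N(p,q)$. Meets $\wedge$ of elements below are taken in $M$. **Vectors.** A vector is a family $\mathbf{c} = (c_{xy} \mid x \succ y \text{ in } P)$ with $c_{xy} \in N(x,y)$; vectors are ordered componentwise. $\mathbf{c}$ is compatible if $c_{xy} \wedge x'(y') = c_{x'y'} \wedge x(y)$ for all $x \succ y$, $x' \succ y'$ in $P$. Compatible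 vectors are identified with the ideals of $M$ and form the lattice $\mathrm{Id}\,M$. A sectional complement of $\mathbf u$ in $\mathbf v$ is an $\mathbf s$ in $\mathrm{Id}\,M$ with $\mathbf u\wedge \mathbf s=0$ and $\mathbf u\vee \mathbf s=\mathbf v$. **The vector $\mathbf{m}$.** For compatible $\mathbf{u} \le \mathbf{v}$, $\mathbf{m} = (m_{xy})$, where $m_{xy}$ is the largest element $s \in N(x,y)$ with $u_{xy} \wedge s = 0$ and $u_{xy} \vee s = v_{xy}$ (it exists). **$\mathcal V$-failures and $\mathcal V$-cuts.** A $\mathcal V$-suborder is $\{p,q,r\} \subseteq P$ with $p \ne q$, $p \succ r$, $q \succ r$. A vector $\mathbf{c}$ is $\mathcal V$-incompatible at $\{p,q,r\}$ if $c_{pr} \wedge r \ne c_{qr} \wedge r$; it has a $\mathcal V(p,q,r)$-failure if in addition $c_{pr} = m_{pr}$ and $c_{qr} = m_{qr}$. In case of a failure it is known that, up to interchanging $p,q$ and interchanging $r_1,r_2$, $m_{pr} = r_1$ and $m_{qr} = q_1$; the corresponding $\mathcal V$-cut of $\mathbf{c}$ replaces $c_{pr}$ by $0$ and leaves all other components unchanged. **$\mathcal C$-failures and $\mathcal C$-cuts.** A $\mathcal C$-suborder is $\{p,q,r\}\subseteq P$ with $p \succ q \succ r$. A vector $\mathbf{c}$ is $\mathcal C$-incompatible at it if $c_{pq} \wedge q_1 \ne c_{qr} \wedge q_1$; it has a $\mathcal C(p,q,r)$-failure if in addition $c_{pq} = m_{pq}$ and $c_{qr} = m_{qr}$. In case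 of a failure it is known that $m_{pq} = p_1$ and $m_{qr} \in \{q_1, q(r)\}$; the corresponding $\mathcal C$-cut of $\mathbf{c}$ replaces $c_{qr}$ by $0$ if $m_{qr} = q_1$, and by $r$ if $m_{qr} = q(r)$, leaving all other components unchanged. A $\mathcal C(p,q,r)$-failure of $\mathbf{c}$ is minimal if there is no $\mathcal C(p',q',r')$-failure of $\mathbf{c}$ with $q' < q$. **Algorithm.** Given compatible $\mathbf{u} \le \mathbf{v}$. Step 1: set $\mathbf{c} = \mathbf{m}$. Step 2: choose an arbitrary $\mathcal V$-failure of $\mathbf{c}$ (if any) and replace $\mathbf{c}$ by the corresponding $\mathcal V$-cut; repeat until there are no more $\mathcal V$-failures. Step 3: choose a minimal $\mathcal C$-failure of $\mathbf{c}$ (if any) and replace $\mathbf{c}$ by the corresponding $\mathcal C$-cut; repeat until there are no more $\mathcal C$-failures. The final $\mathbf{c}$ is the output. It is known from earlier work (Grätzer–Roddy) that the output is compatible and is a sectional complement of $\mathbf u$ in $\mathbf v$ in $\mathrm{Id}\,M$. **The 1960 sectional complement.** An atom $a$ of $M$ is regarded as the compatible vector whose $(x,y)$ component is $a$ if $a \in N(x,y)$ and $0$ otherwise. For a vector $\mathbf{c}$, $\mathrm{At}(\mathbf{c})$ is the set of atoms $a$ of $M$ with $a \le \mathbf{c}$. An element $q \in P$ splits over $(\mathbf{u},\mathbf{v})$ if there exist $p \succ q$ in $P$ and $i \in \{1,2\}$ with $p_1, q_i \in \mathrm{At}(\mathbf{v}) - \mathrm{At}(\mathbf{u})$ and $q_{i+1}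 \in \mathrm{At}(\mathbf{u})$ (indices modulo $2$). $\mathrm{Split}(\mathbf{u},\mathbf{v})$ is the set of all $q_i \in \mathrm{At}(\mathbf{v}) - \mathrm{At}(\mathbf{u})$ such that $q$ splits over $(\mathbf{u},\mathbf{v})$. Then $$\mathbf{s}_{1960} = \bigvee \big((\mathrm{At}(\mathbf{v}) - \mathrm{At}(\mathbf{u})) - \mathrm{Split}(\mathbf{u},\mathbf{v})\big),$$ the join being taken in $\mathrm{Id}\,M$ (i.e., the least compatible vector above all these atoms). *)

(* Defs.v *)
From HB Require Import structures.
From mathcomp Require Import all_boot all_order.

Set Implicit Arguments.
Unset Strict Implicit.
Unset Printing Implicit Defensive.

Import Order.TTheory.
Local Open Scope order_scope.

Definition covers (d : Order.disp_t) (P : finPOrderType d) : rel P :=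
  fun x y => (y < x) && [forall z, ~~ ((y < z) && (z < x))].

Arguments covers {d P}.

(* Formal names: 0, p_1 = Atm p false, p_2 = Atm p true, p = Elt p, and
   p(q) = Top p q. *)
Inductive name (T : Type) :=
  | Zero
  | Atm of T & bool
  | Elt of T
  | Top of T & T.

Arguments Zero {T}.

Section NameFinite.
Variable T : finType.

Definition name_code (n : name T) : unit + (T * bool) + (T + T * T) :=
  match n with
  | Zero => inl (inl tt)
  | Atm p i => inl (inr (p, i))
  | Elt p => inr (inl p)
  | Top p q => inr (inr (p, q))
  end.

Definition name_decode (c : unit + (T * bool) + (T + T * T)) : name T :=
  match c with
  | inl (inl _) => Zero
  | inl (inr (p, i)) => Atm p i
  | inr (inl p) => Elt p
  | inr (inr (p, q)) => Top p q
  end.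

Lemma name_codeK : cancel name_code name_decode.
Proof. by case. Qed.

HB.instance Definition _ := Finite.copy (name T) (can_type name_codeK).

Lemma name_eqE (a b : name T) : (a == b) =
  match a, b with
  | Zero, Zero => true
  | Atm p i, Atm q j => (p == q) && (i == j)
  | Elt p, Elt q => p == q
  | Top p q, Top x y => (p == x) && (q == y)
  | _, _ => false
  end.
Proof.
apply/eqP/idP => [->|]; first by case: b => * /=; rewrite ?eqxx.
by case: a b => [|p i|p|p q] [|x j|x|x y] //= => [/andP[]|/eqP->|/andP[]] //
  => /eqP-> /eqP->.
Qed.

Definition Nset (p q : T) : {set name T} :=
  [set n in [:: Zero; Atm p false; Atm q false; Atm q true; Elt q; Top p q]].

Definition Ncov (p q : T) : rel (name T) := fun a b =>
  (a, b) \in [:: (Zero, Atm q false); (Atm q false, Elt q);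
                 (Zero, Atm q true);  (Atm q true, Elt q);
                 (Elt q, Top p q);
                 (Zero, Atm p false); (Atm p false, Top p q)].

Definition Nle (p q : T) : rel (name T) := fun a b =>
  [&& a \in Nset p q, b \in Nset p q & connect (Ncov p q) a b].

Definition name_le : rel (name T) := fun a b =>
  match a, b with
  | Zero, _ => true
  | Atm p i, Atm q j => (p == q) && (i == j)
  | Atm p i, Elt q => p == q
  | Atm p i, Top x y => (p == y) || (p == x) && ~~ i
  | Elt p, Elt q => p == q
  | Elt p, Top x y => p == y
  | Top p q, Top x y => (p == x) && (q == y)
  | _, _ => false
  end.

Definition name_meet (a b : name T) : name T :=
  if name_le a b then a else if name_le b a then b else
  match a, b with
  | Elt p, Top x y | Top x y, Elt p => if p == x then Atm p false else Zero
  | Top x y, Top x' y' =>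
      if y == y' then Elt y
      else if (x == x') || (x == y') then Atm x false
      else if x' == y then Atm x' false
      else Zero
  | _, _ => Zero
  end.

Lemma NsetE p q n : (n \in Nset p q) =
  match n with
  | Zero => true
  | Atm x i => (x == q) || (x == p) && ~~ i
  | Elt x => x == q
  | Top x y => (x == p) && (y == q)
  end.
Proof.
rewrite !inE; case: n => [|x i|x|x y]; rewrite !name_eqE ?orbF //=.
by case: (x == p) (x == q) i => [] [] [].
Qed.

Lemma name_le_refl : reflexive name_le.
Proof. by case => * /=; rewrite ?eqxx. Qed.

Ltac name_tac := repeat (case: eqP => //= ?); intros; subst => //=;
  rewrite ?eqxx ?andbT ?orbT //; try congruence.

Lemma name_le_anti : antisymmetric name_le.
Proof. by case=> [|p []|p|p q] [|x []|x|x y] //=; name_tac. Qed.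

Lemma name_le_trans : transitive name_le.
Proof.
by move=> [|p [] |p|p q] [|x [] |x|x y] [|z [] |z|z w] //=; name_tac.
Qed.

Lemma name_le_N p q a b : name_le a b -> b \in Nset p q -> a \in Nset p q.
Proof.
by rewrite !NsetE; case: a b => [|x [] |x|x y] [|z [] |z|z w] //=; name_tac.
Qed.

Lemma NleE p q a b :
  Nle p q a b = [&& a \in Nset p q, b \in Nset p q & name_le a b].
Proof.
rewrite /Nle; case aN: (a \in _) => //=; case bN: (b \in _) => //=.
have cov x y : Ncov p q x y -> name_le x y.
  by rewrite /Ncov !inE; do ![case/orP]; move=> /eqP[-> ->] /=; rewrite ?eqxx ?orbT.
apply/idP/idP => [/connectP[s + ->]|].
  elim: s a {aN bN} => [|c s IH] a /=; first by rewrite name_le_refl.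
  by move=> /andP[/cov ac /IH]; apply: name_le_trans.
have step x y : (x, y) \in [:: (Zero, Atm q false); (Atm q false, Elt q);
    (Zero, Atm q true); (Atm q true, Elt q); (Elt q, Top p q);
    (Zero, Atm p false); (Atm p false, Top p q)] -> connect (Ncov p q) x y.
  by move=> xy; apply: (@connect1 _ (Ncov p q)).
have c1 i : connect (Ncov p q) Zero (Atm q i).
  by apply: step; case: i; rewrite !inE eqxx ?orbT.
have c2 i : connect (Ncov p q) (Atm q i) (Elt q).
  by apply: step; case: i; rewrite !inE eqxx ?orbT.
have c3 : connect (Ncov p q) (Elt q) (Top p q).
  by apply: step; rewrite !inE eqxx ?orbT.
have c4 : connect (Ncov p q) Zero (Atm p false).
  by apply: step; rewrite !inE eqxx ?orbT.
have c5 : connect (Ncov p q) (Atm p false) (Top p q).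
  by apply: step; rewrite !inE eqxx ?orbT.
have c6 i := connect_trans (c2 i) c3.
have c7 := connect_trans (c1 true) (c2 true).
have c8 := connect_trans c7 c3.
move: aN bN; rewrite !NsetE.
case: a b => [|x i|x|x y] [|z j|z|z w] //=.
- by move=> _ /orP[/eqP->|/andP[/eqP-> /negPf->]].
- by move=> _ /eqP->.
- by move=> _ /andP[/eqP-> /eqP->].
- by move=> _ _ /andP[/eqP-> /eqP->].
- by move=> _ /eqP-> /eqP->.
- by move=> + /andP[/eqP-> /eqP->] => /orP[/eqP->|/andP[/eqP-> /negPf->]].
- by move=> _ _ /eqP->.
- by move=> /eqP-> /andP[/eqP-> /eqP->].
- by move=> _ _ /andP[/eqP-> /eqP->].
Qed.

End NameFinite.

Section Chopped.
Context {d : Order.disp_t} (P : finPOrderType d).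

Record cpair := CPair {
  cpair_val : P * P;
  _ : covers cpair_val.1 cpair_val.2 }.

HB.instance Definition _ := [isSub for cpair_val].
HB.instance Definition _ := [Finite of cpair by <:].

Definition hi (e : cpair) : P := (val e).1.
Definition lo (e : cpair) : P := (val e).2.

(* chopped is M; 0 is kept as an element even when P has no covering pair. *)
Definition in_chopped (n : name P) : bool :=
  (n == Zero) || [exists e : cpair, n \in Nset (hi e) (lo e)].

Record chopped := Chopped {
  cname : name P;
  _ : in_chopped cname }.

HB.instance Definition _ := [isSub for cname].
HB.instance Definition _ := [Finite of chopped by <:].

Definition chopped_le : rel chopped := fun a b =>
  (a == b) || [exists e : cpair, Nle (hi e) (lo e) (val a) (val b)].

Lemma chopped_leE (a b : chopped) : chopped_le a b = name_le (val a) (val b).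
Proof.
rewrite /chopped_le; apply/idP/idP => [/orP[/eqP->|/existsP[e]]|ab].
- exact: name_le_refl.
- by rewrite NleE => /and3P[].
case/orP: (valP b) => [/eqP b0|/existsP[e be]].
  apply/orP; left; apply/eqP/val_inj; move: ab; rewrite b0.
  by case: (val a).
apply/orP; right; apply/existsP; exists e.
by rewrite NleE be ab (name_le_N ab be).
Qed.

Lemma chopped_le_refl : reflexive chopped_le.
Proof. by move=> a; rewrite chopped_leE name_le_refl. Qed.

Lemma chopped_le_anti : antisymmetric chopped_le.
Proof. by move=> a b; rewrite !chopped_leE => /name_le_anti /val_inj. Qed.

Lemma chopped_le_trans : transitive chopped_le.
Proof. by move=> b a c; rewrite !chopped_leE; apply: name_le_trans. Qed.

HB.instance Definition _ := Order.Le_isPOrder.Build d chopped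
  chopped_le_refl chopped_le_anti chopped_le_trans.

Lemma leE_name (a b : chopped) : (a <= b) = name_le (val a) (val b).
Proof. exact: chopped_leE. Qed.

Lemma chopped0_proof : in_chopped Zero.
Proof. by rewrite /in_chopped eqxx. Qed.

Definition chopped0 := Chopped chopped0_proof.

Lemma chopped_le0x (a : chopped) : chopped0 <= a.
Proof. by rewrite leE_name. Qed.

HB.instance Definition _ := Order.hasBottom.Build d chopped chopped_le0x.

Lemma cpair_lt (e : cpair) : lo e < hi e.
Proof. by case/andP: (valP e). Qed.

Lemma in_choppedTop x y : in_chopped (Top x y) -> y < x.
Proof.
case/orP=> [|/existsP[e]]; first by rewrite name_eqE.
by rewrite NsetE => /andP[/eqP-> /eqP->]; apply: cpair_lt.
Qed.

Lemma name_meet_glb (a b c : name P) : in_chopped a -> in_chopped b ->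
  name_le c (name_meet a b) = name_le c a && name_le c b.
Proof.
move=> aM bM; rewrite /name_meet.
case: ifP => [ab|nab].
  by apply/idP/andP => [ca|[]//]; split=> //; apply: name_le_trans ab.
case: ifP => [ba|nba].
  by apply/idP/andP => [cb|[]//]; split=> //; apply: name_le_trans ba.
move: aM bM nab nba.
case: a b => [|p i|p|x y] [|p' i'|p'|x' y'] //.
all: try (move=> /in_choppedTop xy || move=> _).
all: try (move=> /in_choppedTop xy' || move=> _).
all: case: c => [|z []|z|z w] //=.
all: repeat (case: eqP => //= ?); intros; subst => //=.
all: try (by rewrite ?andbF); try (by rewrite ltxx in xy).
all: by have := lt_trans xy xy'; rewrite ltxx.
Qed.

Lemma in_chopped_meet (a b : chopped) : in_chopped (name_meet (val a) (val b)).
Proof.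
have: name_le (name_meet (val a) (val b)) (val a).
  have := name_meet_glb (name_meet (val a) (val b)) (valP a) (valP b).
  by rewrite name_le_refl => /esym/andP[].
rewrite /in_chopped; case/orP: (valP a) => [/eqP->|/existsP[e ae] le_a].
  by case: name_meet.
by apply/orP; right; apply/existsP; exists e; apply: name_le_N le_a ae.
Qed.

Definition chopped_meet (a b : chopped) := Chopped (in_chopped_meet a b).

Lemma chopped_meet_glb (a b c : chopped) :
  (c <= chopped_meet a b) = (c <= a) && (c <= b).
Proof. by rewrite !leE_name name_meet_glb ?valP. Qed.

Lemma chopped_meetC : commutative chopped_meet.
Proof.
have H a b c : (c <= chopped_meet a b) = (c <= chopped_meet b a).
  by rewrite !chopped_meet_glb andbC.
by move=> a b; apply/le_anti; rewrite H lexx H lexx.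
Qed.

Lemma chopped_meetA : associative chopped_meet.
Proof.
have H a b c e : (e <= chopped_meet a (chopped_meet b c))
    = (e <= chopped_meet (chopped_meet a b) c).
  by rewrite !chopped_meet_glb andbA.
by move=> a b c; apply/le_anti; rewrite -H lexx H lexx.
Qed.

Lemma chopped_leEmeet (a b : chopped) : (a <= b) = (chopped_meet a b == a).
Proof.
rewrite eq_le chopped_meet_glb lexx /=.
by have := chopped_meet_glb a b (chopped_meet a b); rewrite lexx => /esym/andP[->].
Qed.

HB.instance Definition _ := Order.POrder_Meet_isSemilattice.Build d chopped
  chopped_meetC chopped_meetA chopped_leEmeet.

(* A name that does not denote an element of M is sent to 0. *)
Definition elt (n : name P) : chopped := insubd (\bot : chopped) n.

Definition Nelts (e : cpair) : {set chopped} :=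
  [set a | val a \in Nset (hi e) (lo e)].

Definition top (e : cpair) : chopped := elt (Top (hi e) (lo e)).

Lemma val_elt e n : n \in Nset (hi e) (lo e) -> val (elt n) = n.
Proof.
move=> ne; rewrite /elt val_insubd ifT //.
by apply/orP; right; apply/existsP; exists e.
Qed.

Lemma val_top e : val (top e) = Top (hi e) (lo e).
Proof. by rewrite (@val_elt e) // NsetE !eqxx. Qed.

Lemma mem_N e a : (a \in Nelts e) = (a <= top e).
Proof.
rewrite inE leE_name val_top; apply/idP/idP.
  by rewrite NsetE; case: (val a).
by move/name_le_N; apply; rewrite NsetE !eqxx.
Qed.

Lemma mem_N0 e : \bot \in Nelts e.
Proof. by rewrite mem_N le0x. Qed.

Definition is_join_in (e : cpair) (a b j : chopped) : bool :=
  [&& j \in Nelts e, a <= j, b <= j &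
      [forall c in Nelts e, (a <= c) && (b <= c) ==> (j <= c)]].

Definition sect_compl_in (e : cpair) (a b s : chopped) : bool :=
  [&& s \in Nelts e, a `&` s == \bot & is_join_in e a s b].

Record vec := Vec {
  vec_val : {ffun cpair -> chopped};
  _ : [forall e, vec_val e \in Nelts e] }.

HB.instance Definition _ := [isSub for vec_val].
HB.instance Definition _ := [Finite of vec by <:].

Definition vec_fun (c : vec) (e : cpair) : chopped := vec_val c e.
Coercion vec_fun : vec >-> Funclass.

Lemma mk_vec_proof (f : cpair -> chopped) : (forall e, f e \in Nelts e) ->
  [forall e, [ffun e => f e] e \in Nelts e].
Proof. by move=> H; apply/forallP => e; rewrite ffunE. Qed.

Definition mk_vec f (fN : forall e, f e \in Nelts e) : vec := Vec (mk_vec_proof fN).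

Lemma mk_vecE f (fN : forall e, f e \in Nelts e) : mk_vec fN =1 f.
Proof. by move=> e; rewrite /vec_fun /= ffunE. Qed.

Lemma vecN (c : vec) e : c e \in Nelts e.
Proof. exact: (forallP (valP c)). Qed.

Lemma vecP (c c' : vec) : c =1 c' -> c = c'.
Proof. by move=> H; apply/val_inj/ffunP. Qed.

Definition vec_le : rel vec := fun c c' => [forall e, c e <= c' e].

Lemma vec_le_refl : reflexive vec_le.
Proof. by move=> c; apply/forallP. Qed.

Lemma vec_le_anti : antisymmetric vec_le.
Proof.
move=> c c' /andP[/forallP H /forallP H']; apply/vecP => e.
by apply/le_anti; rewrite H H'.
Qed.

Lemma vec_le_trans : transitive vec_le.
Proof.
move=> c b c' /forallP H /forallP H'; apply/forallP => e.
exact: le_trans (H e) (H' e).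
Qed.

HB.instance Definition _ := Order.Le_isPOrder.Build d vec
  vec_le_refl vec_le_anti vec_le_trans.

Lemma vec_leP (c c' : vec) : reflect (forall e, c e <= c' e) (c <= c').
Proof. exact: forallP. Qed.

Definition compatible (c : vec) : bool :=
  [forall e, forall f, c e `&` top f == c f `&` top e].

(* Id M, as the set of compatible vectors. *)
Record idM := IdM {
  idM_vec :> vec;
  _ : compatible idM_vec }.

HB.instance Definition _ := [isSub for idM_vec].
HB.instance Definition _ := [Finite of idM by <:].
HB.instance Definition _ := [SubChoice_isSubPOrder of idM by <: with d].

Lemma idM_leP (u v : idM) : reflect (forall e, u e <= v e) (u <= v).
Proof. exact: (vec_leP (idM_vec u) (idM_vec v)). Qed.

Lemma compatibleP (c : vec) :
  reflect (forall e f, c e `&` top f = c f `&` top e) (compatible c).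
Proof.
apply: (iffP forallP) => H e; first by move=> f; apply/eqP/(forallP (H e)).
by apply/forallP => f; apply/eqP.
Qed.

Lemma idM_compat (u : idM) e f : u e `&` top f = u f `&` top e.
Proof. by case: u => c /= /compatibleP. Qed.

Definition vec0 : vec := mk_vec mem_N0.

Lemma vec0_compatible : compatible vec0.
Proof. by apply/compatibleP => e f; rewrite !mk_vecE !meet0x. Qed.

Definition idM0 := IdM vec0_compatible.

Lemma idM_le0x (u : idM) : idM0 <= u.
Proof. by apply/idM_leP => e; rewrite mk_vecE le0x. Qed.

HB.instance Definition _ := Order.hasBottom.Build d idM idM_le0x.

Lemma top_N e : top e \in Nelts e.
Proof. by rewrite mem_N. Qed.

Definition vec1 : vec := mk_vec top_N.

Lemma vec1_compatible : compatible vec1.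
Proof. by apply/compatibleP => e f; rewrite !mk_vecE meetC. Qed.

Definition idM1 := IdM vec1_compatible.

Lemma idM_lex1 (u : idM) : u <= idM1.
Proof. by apply/idM_leP => e; rewrite mk_vecE -mem_N vecN. Qed.

HB.instance Definition _ := Order.hasTop.Build d idM idM_lex1.

Lemma vec_meet_N (c c' : vec) e : c e `&` c' e \in Nelts e.
Proof. by rewrite mem_N leIxl // -mem_N vecN. Qed.

Definition vec_meet (c c' : vec) : vec := mk_vec (vec_meet_N c c').

Lemma vec_meet_compatible (u v : idM) : compatible (vec_meet u v).
Proof.
apply/compatibleP => e f; rewrite !mk_vecE.
have H (a b t : chopped) : a `&` b `&` t = (a `&` t) `&` (b `&` t).
  by rewrite meetACA meetxx.
by rewrite [LHS]H [RHS]H idM_compat (idM_compat v).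
Qed.

Definition idM_meet (u v : idM) : idM := IdM (vec_meet_compatible u v).

Lemma idM_meetE (u v : idM) e : idM_meet u v e = u e `&` v e.
Proof. exact: mk_vecE. Qed.

Lemma idMP (u v : idM) : u =1 v -> u = v.
Proof. by move=> H; apply/val_inj/vecP. Qed.

Lemma idM_meetC : commutative idM_meet.
Proof. by move=> u v; apply/idMP => e; rewrite !idM_meetE meetC. Qed.

Lemma idM_meetA : associative idM_meet.
Proof. by move=> u v w; apply/idMP => e; rewrite !idM_meetE meetA. Qed.

Lemma idM_leEmeet (u v : idM) : (u <= v) = (idM_meet u v == u).
Proof.
apply/idM_leP/eqP => [H|<- e]; last by rewrite idM_meetE leIr.
by apply/idMP => e; rewrite idM_meetE; apply/meet_idPl.
Qed.

HB.instance Definition _ := Order.POrder_Meet_isSemilattice.Build d idM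
  idM_meetC idM_meetA idM_leEmeet.

(* The least compatible vector above u and v. *)
Definition idM_join (u v : idM) : idM := \meet_(w : idM | (u <= w) && (v <= w)) w.

Lemma idM_joinP (u v w : idM) : (idM_join u v <= w) = (u <= w) && (v <= w).
Proof.
apply/idP/andP => [jw|[uw vw]]; last by apply: meets_inf; rewrite uw.
by split; apply: le_trans jw; apply/meetsP => x /andP[].
Qed.

Lemma idM_joinC : commutative idM_join.
Proof.
have H u v w : (idM_join u v <= w) = (idM_join v u <= w).
  by rewrite !idM_joinP andbC.
by move=> u v; apply/le_anti; rewrite -H lexx H lexx.
Qed.

Lemma idM_joinA : associative idM_join.
Proof.
have H u v w x : (idM_join u (idM_join v w) <= x)
    = (idM_join (idM_join u v) w <= x).
  by rewrite !idM_joinP andbA.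
by move=> u v w; apply/le_anti; rewrite H lexx -H lexx.
Qed.

Lemma idM_leEjoin (u v : idM) : (v <= u) = (idM_join u v == u).
Proof.
rewrite eq_le idM_joinP lexx /=.
have := idM_joinP u v (idM_join u v); rewrite lexx => /esym/andP[-> _].
by rewrite andbT.
Qed.

HB.instance Definition _ := Order.POrder_Join_isSemilattice.Build d idM
  idM_joinC idM_joinA idM_leEjoin.

Definition sectional_complement (u v s : idM) : Prop :=
  u `&` s = \bot /\ u `|` s = v.

Definition m_val (u v : vec) (e : cpair) : chopped :=
  odflt \bot [pick s | sect_compl_in e (u e) (v e) s &
                [forall t, sect_compl_in e (u e) (v e) t ==> (t <= s)]].

Lemma m_val_N u v e : m_val u v e \in Nelts e.
Proof.
rewrite /m_val; case: pickP => [s /andP[/and3P[]]|] //=.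
by rewrite mem_N0.
Qed.

Definition m_vec (u v : vec) : vec := mk_vec (m_val_N u v).

(* N(x, y) modelled on names over bool, true and false standing for x and y. *)
Section Model.
Variable e : cpair.

Let L : seq (name bool) :=
  [:: Zero; Atm true false; Atm false false; Atm false true; Elt false;
      Top true false].

Let g (b : bool) : P := if b then hi e else lo e.

Let ng (x : name bool) : name P :=
  match x with
  | Zero => Zero
  | Atm b i => Atm (g b) i
  | Elt b => Elt (g b)
  | Top b c => Top (g b) (g c)
  end.

Let R (x : name bool) : chopped := elt (ng x).

Let R_surj a : a \in Nelts e -> exists2 x, x \in L & a = R x.
Proof.
rewrite inE NsetE => H.
suff [x xL ax]: exists2 x, x \in L & val a = ng x.
  by exists x; rewrite // /R -ax /elt valKd.
case: (val a) H => [|x i|x|x y].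
- by exists Zero.
- case/orP=> [/eqP->|/andP[/eqP-> /negPf->]]; last by exists (Atm true false).
  by exists (Atm false i) => //; case: i.
- by move/eqP->; exists (Elt false).
- by move=> /andP[/eqP-> /eqP->]; exists (Top true false).
Qed.

Let ng_N x : x \in L -> ng x \in Nset (hi e) (lo e).
Proof.
by case: x => [|[] []|[]|[] []] // _; rewrite NsetE /= ?eqxx ?orbT.
Qed.

Let R_N x : x \in L -> R x \in Nelts e.
Proof. by move=> xL; rewrite inE (@val_elt e) ?ng_N. Qed.

Let R_le x y : x \in L -> y \in L -> (R x <= R y) = name_le x y.
Proof.
move=> xL yL; rewrite leE_name !(@val_elt e) ?ng_N //.
have ne : (hi e == lo e) = false by apply/gt_eqF/cpair_lt.
have ne' : (lo e == hi e) = false by rewrite eq_sym.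
by case: x y xL yL => [|[] []|[]|[] []] [|[] []|[]|[] []] // _ _;
  rewrite /= ?eqxx ?ne ?ne'.
Qed.

Let R_all (Q : pred chopped) :
  [forall c in Nelts e, Q c] = all (fun x => Q (R x)) L.
Proof.
apply/forallP/allP => [H x xL|H c].
  by have /implyP := H (R x); apply; apply: R_N.
by apply/implyP => /R_surj[x xL ->]; apply: H.
Qed.

Let disj (x y : name bool) :=
  all (fun z => name_le z x && name_le z y ==> (z == Zero)) L.

Let R_meet x y : x \in L -> y \in L -> (R x `&` R y == \bot) = disj x y.
Proof.
move=> xL yL; have zL : Zero \in L by rewrite inE eqxx.
have R0 : R Zero = \bot by apply/val_inj; rewrite (@val_elt e) ?ng_N.
have nle0 (z : name bool) : name_le z Zero = (z == Zero) by case: z.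
apply/eqP/allP => [xy0 z zL'|H].
  apply/implyP => zxy; rewrite -nle0 -(R_le zL' zL) R0 -xy0 lexI.
  by rewrite !R_le.
have /R_surj[z zL' zE]: R x `&` R y \in Nelts e.
  by rewrite mem_N leIxl // -mem_N R_N.
have /eqP z0 : z == Zero.
  have /implyP := H z zL'; apply.
  by rewrite -!R_le // -zE leIl leIr.
by rewrite zE z0.
Qed.

Let sc (a b s : name bool) := [&& disj a s, name_le a b, name_le s b &
  all (fun c => name_le a c && name_le s c ==> name_le b c) L].

Let R_sc a b s : a \in L -> b \in L -> s \in L ->
  sect_compl_in e (R a) (R b) (R s) = sc a b s.
Proof.
move=> aL bL sL; rewrite /sect_compl_in /is_join_in !R_N // R_meet // !R_le //.
rewrite R_all /sc !andTb; congr [&& _, _, _ & _].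
by apply: eq_in_all => c cL; rewrite !R_le.
Qed.

Lemma sect_compl_in_max (a b : chopped) : a \in Nelts e -> b \in Nelts e -> a <= b ->
  exists s, sect_compl_in e a b s /\
    forall t, sect_compl_in e a b t -> t <= s.
Proof.
move=> /R_surj[x xL ->] /R_surj[y yL ->]; rewrite R_le // => xy.
have: has (fun s => sc x y s && all (fun t => sc x y t ==> name_le t s) L) L.
  by case: x y xL yL xy => [|[] []|[]|[] []] [|[] []|[]|[] []].
case/hasP=> s sL /andP[scs /allP H]; exists (R s); split; first by rewrite R_sc.
move=> t ts; have /andP[/R_surj[z zL tE] _] := ts; move: ts; rewrite tE R_sc //.
by move=> scz; rewrite R_le //; have /implyP := H z zL; apply.
Qed.

End Model.

Lemma m_vecP (u v : vec) e : u <= v ->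
  sect_compl_in e (u e) (v e) (m_vec u v e) /\
  forall s, sect_compl_in e (u e) (v e) s -> s <= m_vec u v e.
Proof.
move=> /vec_leP/(_ e) uv; rewrite mk_vecE /m_val.
case: pickP => [s /andP[? /forallP H]|none].
  by split=> // t; apply/implyP.
have [s [sP smax]] := sect_compl_in_max (vecN u e) (vecN v e) uv.
have := none s; rewrite sP /= => /negP[].
by apply/forallP => t; apply/implyP/smax.
Qed.

(* c' is c with the component c_e replaced by a. *)
Definition is_update (c : vec) (e : cpair) (a : chopped) (c' : vec) : bool :=
  [forall g, c' g == if g == e then a else c g].

(* V-suborders {p, q, r} are given by e = (p, r) and f = (q, r). *)
Definition V_suborder (e f : cpair) : bool := (hi e != hi f) && (lo e == lo f).

Definition V_incompatible (c : vec) (e f : cpair) : bool :=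
  c e `&` elt (Elt (lo e)) != c f `&` elt (Elt (lo e)).

Definition V_failure (m c : vec) (e f : cpair) : bool :=
  [&& V_suborder e f, V_incompatible c e f, c e == m e & c f == m f].

Definition V_cut (m c c' : vec) : bool :=
  [exists e, exists f, exists i,
    [&& V_failure m c e f, m e == elt (Atm (lo e) i),
        m f == elt (Atm (hi f) false) & is_update c e \bot c']].

(* C-suborders p > q > r are given by e = (p, q) and f = (q, r). *)
Definition C_suborder (e f : cpair) : bool := lo e == hi f.

Definition C_incompatible (c : vec) (e f : cpair) : bool :=
  c e `&` elt (Atm (hi f) false) != c f `&` elt (Atm (hi f) false).

Definition C_failure (m c : vec) (e f : cpair) : bool :=
  [&& C_suborder e f, C_incompatible c e f, c e == m e & c f == m f].

Definition C_minimal_failure (m c : vec) (e f : cpair) : bool :=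
  C_failure m c e f &&
  [forall e', forall f', C_failure m c e' f' ==> ~~ (hi f' < hi f)].

Definition C_cut (m c c' : vec) : bool :=
  [exists e, exists f, C_minimal_failure m c e f &&
    ((m f == elt (Atm (hi f) false)) && is_update c f \bot c'
  || (m f == top f) && is_update c f (elt (Elt (lo f))) c')].

Definition algorithm_output (u v s : vec) : bool :=
  let m := m_vec u v in
  [exists c, [&& connect (V_cut m) m c, [forall e, forall f, ~~ V_failure m c e f],
    connect (C_cut m) c s & [forall e, forall f, ~~ C_failure m s e f]]].

Definition atom (a : chopped) : bool := covers a \bot.

Definition atom_val (a : chopped) (e : cpair) : chopped :=
  if a \in Nelts e then a else \bot.

Lemma atom_val_N a e : atom_val a e \in Nelts e.
Proof. by rewrite /atom_val; case: ifP => // _; apply: mem_N0. Qed.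

Definition atom_vec (a : chopped) : vec := mk_vec (atom_val_N a).

Lemma atom_vec_compatible a : atom a -> compatible (atom_vec a).
Proof.
case/andP=> _ /forallP H.
have at0 t : ~~ (a <= t) -> a `&` t = \bot.
  move=> nat; apply/eqP; move: (H (a `&` t)); apply: contraR => nz.
  rewrite lt0x nz /= lt_neqAle leIl andbT; apply: contra nat => /eqP <-.
  exact: leIr.
apply/compatibleP => e f; rewrite !mk_vecE /atom_val !mem_N.
have [ae|/at0 ae] := boolP (a <= top e); have [af|/at0 af] := boolP (a <= top f).
- by rewrite (meet_idPl ae) (meet_idPl af).
- by rewrite af meet0x.
- by rewrite ae meet0x.
- by rewrite !meet0x.
Qed.

(* An atom as an element of Id M; only used for atoms. *)
Definition atom_idM (a : chopped) : idM := insubd (\bot : idM) (atom_vec a).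

Lemma atom_idM_vec a : atom a -> atom_idM a = atom_vec a :> vec.
Proof. by move=> /atom_vec_compatible H; rewrite /atom_idM [LHS]val_insubd H. Qed.

Definition At (c : vec) : {set chopped} := [set a | atom a & atom_vec a <= c].

(* The index i + 1 modulo 2 is ~~ i. *)
Definition splits_at (u v : vec) (q : P) (i : bool) : bool :=
  [exists e, [&& lo e == q,
    elt (Atm (hi e) false) \in At v :\: At u,
    elt (Atm q i) \in At v :\: At u &
    elt (Atm q (~~ i)) \in At u]].

Definition splits (u v : vec) (q : P) : bool := [exists i, splits_at u v q i].

Definition Split (u v : vec) : {set chopped} :=
  [set a in At v :\: At u |
    [exists q, splits u v q && [exists i, a == elt (Atm q i)]]].

Definition s1960 (u v : vec) : idM :=
  \join_(a in (At v :\: At u) :\: Split u v) atom_idM a.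

End Chopped.

(* Main.v *)
(* An ideal of M is determined by its atoms, and the sets of atoms that occur are
   those closed under: p_1 and q_i present with p covering q forces q_1 and q_2.
   Let D = At v - At u.  The component m_pq has the atoms of D in N(p,q), except
   that q_i is dropped when p itself witnesses that q splits (p_1, q_i in D, the
   other q_j in u).  The V-cuts remove exactly the remaining q_i with q
   splitting, witnessed by some other element; the C-cuts remove exactly the p_1
   with p splitting.  Processing the minimal C-failures first guarantees that a
   component (p',p) witnessing that p splits is still uncut when p_1 has to be
   removed from (p,q).  So the output has the atoms D - Split, and this set is
   already closed.  It generates v together with u by induction from the top of P
   downwards: if q splits, its witness p_1 is in the join, hence so is q_i. *)
Require Import Defs.
From mathcomp Require Import all_boot all_order.

Import Order.TTheory.
Local Open Scope order_scope.

(** * Elements of [M] and compatible vectors described by their atoms *)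

Section Atoms.
Set Implicit Arguments.
Unset Strict Implicit.
Unset Printing Implicit Defensive.
Context {d : Order.disp_t} {P : finPOrderType d}.
Implicit Types (a b : chopped P) (e f : cpair P) (p : P) (i j : bool).
Implicit Types (u v w : idM P) (c : vec P).

(** Comparing names rather than elements keeps this meaningful when [p_i] does not occur in [M]: it
    is then false, with no default value of [elt] in the way. *)
Definition atm_le p i a : bool := name_le (Atm p i) (val a).

Lemma lo_neq_hi e : (lo e == hi e) = false.
Proof. exact/lt_eqF/cpair_lt. Qed.

Lemma hi_neq_lo e : (hi e == lo e) = false.
Proof. exact/gt_eqF/cpair_lt. Qed.

(** Only [q] and the elements [x(q)] lie above both [q_1] and [q_2]; if such an [x(q)] also lies
    above [p_1] with [p] different from [q], then [x = p]. *)
Lemma chopped_le_atm a b :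
  (forall p i, atm_le p i a -> atm_le p i b) -> a <= b.
Proof.
rewrite leE_name /atm_le; have := valP a.
case: (val a) => [|p i|p|p q] //= aM H; first by apply: H; rewrite !eqxx.
  have := H p true; have := H p false; rewrite eqxx.
  by case: (val b) => [|x []|x|x y] /=; rewrite ?andbF ?andbT ?orbF; auto.
have qp := in_choppedTop aM; have pq := gt_eqF qp.
have := H q true; have := H q false; have := H p false; rewrite !eqxx orbT /=.
case: (val b) => [|x []|x|x y] /=; rewrite ?andbF ?andbT ?orbF.
- by move=> /(_ isT).
- by move=> /(_ isT).
- by move=> _ _ /(_ isT).
- by move=> /(_ isT)/eqP<- /(_ isT); rewrite lt_eqF.
- move=> + _ /(_ isT)/eqP qy; rewrite -qy pq eqxx andbT /=; exact.
Qed.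

Lemma atm_le_trans p i a b : a <= b -> atm_le p i a -> atm_le p i b.
Proof. by rewrite leE_name => ab /name_le_trans; apply. Qed.

Lemma chopped_atm_eq a b :
  (forall p i, atm_le p i a = atm_le p i b) -> a = b.
Proof. by move=> H; apply/le_anti/andP; split; apply: chopped_le_atm => p i;
  rewrite H. Qed.

Lemma atm_leI p i a b : atm_le p i (a `&` b) = atm_le p i a && atm_le p i b.
Proof. by rewrite /atm_le (@name_meet_glb _ _ (val a) (val b)) ?valP. Qed.

Lemma atm_le0 p i : atm_le p i (\bot : chopped P) = false.
Proof. by []. Qed.

Lemma atm_leN e p i a : a \in Nelts e -> atm_le p i a -> Atm p i \in Nset (hi e) (lo e).
Proof. by rewrite inE => aN /name_le_N; apply. Qed.

Lemma Nset_lo e i : Atm (lo e) i \in Nset (hi e) (lo e).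
Proof. by rewrite NsetE eqxx. Qed.

Lemma Nset_hi e : Atm (hi e) false \in Nset (hi e) (lo e).
Proof. by rewrite NsetE eqxx orbT. Qed.

Lemma N_le e a b : a \in Nelts e ->
  (atm_le (hi e) false a -> atm_le (hi e) false b) ->
  (forall i, atm_le (lo e) i a -> atm_le (lo e) i b) -> a <= b.
Proof.
move=> aN H L; apply: chopped_le_atm => p i pa.
have := atm_leN aN pa; rewrite NsetE => /orP[/eqP pE|/andP[/eqP pE]].
  by move: pa; rewrite pE; apply: L.
by move: pa; rewrite pE; case: i => // pa _; apply: H.
Qed.

Lemma N_eq e a b : a \in Nelts e -> b \in Nelts e ->
  atm_le (hi e) false a = atm_le (hi e) false b ->
  (forall i, atm_le (lo e) i a = atm_le (lo e) i b) -> a = b.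
Proof.
move=> aN bN H L; apply/le_anti/andP; split; apply: (@N_le e) => // [|i].
- by rewrite H.
- by rewrite L.
- by rewrite H.
- by rewrite L.
Qed.

(** The only element of [N(p,q)] above [p_1] and some [q_i] is [p(q)]. *)
Lemma N_closed e a i j : a \in Nelts e ->
  atm_le (hi e) false a -> atm_le (lo e) i a -> atm_le (lo e) j a.
Proof.
rewrite inE NsetE /atm_le; case: (val a) => [|x k|x|x y] //=.
- move=> _ /andP[/eqP<- _]; by rewrite lo_neq_hi.
- by move=> /andP[_ /eqP->]; rewrite eqxx.
Qed.

Lemma N_exists e (h : bool) (l : bool -> bool) :
  (forall i j, h -> l i -> l j) ->
  exists2 a, a \in Nelts e &
    atm_le (hi e) false a = h /\ forall i, atm_le (lo e) i a = l i.
Proof.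
move=> cl.
have [n nN [nh nl]] : exists2 n, n \in Nset (hi e) (lo e) &
    name_le (Atm (hi e) false) n = h /\
    forall i, name_le (Atm (lo e) i) n = l i.
  (* Of the eight sets of atoms, closure excludes the two that consist of [p_1] and a single [q_i];
     the other six match the six elements of [N(p,q)]. *)
  move: h l cl => [] l cl; case l0: (l false); case l1: (l true).
  - exists (Top (hi e) (lo e)); first by rewrite NsetE !eqxx.
    by split=> [|[]] /=; rewrite ?eqxx ?orbT ?l0 ?l1.
  - by move: (cl false true isT l0); rewrite l1.
  - by move: (cl true false isT l1); rewrite l0.
  - exists (Atm (hi e) false); first exact: Nset_hi.
    by split=> [|[]] /=; rewrite ?eqxx ?lo_neq_hi ?l0 ?l1.
  - exists (Elt (lo e)); first by rewrite NsetE !eqxx.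
    by split=> [|[]] /=; rewrite ?eqxx ?hi_neq_lo ?l0 ?l1.
  - exists (Atm (lo e) false); first exact: Nset_lo.
    by split=> [|[]] /=; rewrite ?eqxx ?hi_neq_lo ?l0 ?l1.
  - exists (Atm (lo e) true); first exact: Nset_lo.
    by split=> [|[]] /=; rewrite ?eqxx ?hi_neq_lo ?l0 ?l1.
  - exists Zero; first by rewrite NsetE.
    by split=> [|[]] /=; rewrite ?l0 ?l1.
by exists (elt n); [rewrite inE (@val_elt _ _ e)|rewrite /atm_le (@val_elt _ _ e)].
Qed.

(* If p_i does not occur in M then elt sends it to 0, which is not an atom, so
   this is false. *)
Definition at_in c p i : bool := elt (Atm p i) \in At c.

Lemma atom_elt e p i : Atm p i \in Nset (hi e) (lo e) -> atom (elt (Atm p i) : chopped P).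
Proof.
move=> pN; rewrite /atom /covers lt0x; apply/andP; split.
  by apply/eqP => /(congr1 val); rewrite (@val_elt _ _ e).
apply/forallP => z; apply/negP => /andP[]; rewrite !lt_neqAle !leE_name (@val_elt _ _ e) //.
move=> /andP[z0 _] /andP[zp]; case E: (val z) => [|x j|x|x y] //=.
  by move/eqP: z0 => []; apply: val_inj; rewrite E.
move=> /andP[/eqP xp /eqP jp]; move/eqP: zp => []; apply: val_inj.
by rewrite E xp jp (@val_elt _ _ e).
Qed.

Lemma atom_chopped p i : atom (elt (Atm p i) : chopped P) -> in_chopped (Atm p i).
Proof. by rewrite /elt /insubd; case: insubP => //= _; rewrite /atom /covers ltxx. Qed.

Lemma at_inN c p i : at_in c p i -> exists e, Atm p i \in Nset (hi e) (lo e).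
Proof.
rewrite /at_in inE => /andP[/atom_chopped + _] => /orP[|/existsP[e He]].
  by rewrite name_eqE.
by exists e.
Qed.

(** Compatibility carries an atom from one component to every other component whose lattice contains
    it, so one component suffices as a test. *)
Lemma at_inE u e p i : Atm p i \in Nset (hi e) (lo e) ->
  at_in u p i = atm_le p i (u e).
Proof.
move=> pN; rewrite /at_in inE (@atom_elt e) //=.
have leT f : (elt (Atm p i) <= top f) = (Atm p i \in Nset (hi f) (lo f)).
  by rewrite -mem_N inE (@val_elt _ _ e).
have eltl a : (elt (Atm p i) <= a) = atm_le p i a.
  by rewrite leE_name (@val_elt _ _ e).
apply/vec_leP/idP => [/(_ e)|pu f]; rewrite mk_vecE /atom_val mem_N leT.
  by rewrite pN eltl.
case: ifP => // pf; rewrite eltl; apply: (@atm_le_trans _ _ (u f `&` top e)).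
  exact: leIl.
by rewrite -idM_compat atm_leI pu -eltl leT.
Qed.

Lemma at_in_hi u e : at_in u (hi e) false = atm_le (hi e) false (u e).
Proof. exact/at_inE/Nset_hi. Qed.

Lemma at_in_lo u e i : at_in u (lo e) i = atm_le (lo e) i (u e).
Proof. exact/at_inE/Nset_lo. Qed.

Lemma at_in_closed u e i j :
  at_in u (hi e) false -> at_in u (lo e) i -> at_in u (lo e) j.
Proof. rewrite at_in_hi !at_in_lo; exact/N_closed/vecN. Qed.

Lemma idM_le_at u v : (u <= v) <-> (forall p i, at_in u p i -> at_in v p i).
Proof.
split=> [/idM_leP uv p i pu|H].
  have [e pN] := at_inN pu; move: pu; rewrite !(at_inE _ pN).
  exact: atm_le_trans (uv e).
apply/idM_leP => e; apply: (@N_le e); first exact: vecN.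
  by rewrite -!at_in_hi; apply: H.
by move=> i; rewrite -!at_in_lo; apply: H.
Qed.

Lemma idM_eq_at u v : (forall p i, at_in u p i = at_in v p i) -> u = v.
Proof. by move=> H; apply/le_anti/andP; split; apply/idM_le_at => p i;
  rewrite H. Qed.

Lemma at_inI u v p i : at_in (u `&` v : idM P) p i = at_in u p i && at_in v p i.
Proof.
case: (boolP (in_chopped (Atm p i))) => [|/negP out].
  case/orP=> [|/existsP[e pN]]; first by rewrite name_eqE.
  by rewrite !(at_inE _ pN) -atm_leI; congr atm_le; apply: idM_meetE.
have none w : at_in w p i = false.
  by apply/negP; rewrite /at_in inE => /andP[/atom_chopped].
by rewrite !none.
Qed.

(** Meeting the component at [e] with [top f] leaves the atoms of [S] that lie in both lattices.
    This description is symmetric in [e] and [f], so compatibility is automatic. *)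
Lemma idM_exists (S : P -> bool -> bool) :
  (forall e i j, S (hi e) false -> S (lo e) i -> S (lo e) j) ->
  exists w : idM P, forall e, atm_le (hi e) false (w e) = S (hi e) false /\
     forall i, atm_le (lo e) i (w e) = S (lo e) i.
Proof.
move=> cl.
have ex e : exists a, [&& a \in Nelts e, atm_le (hi e) false a == S (hi e) false
    & [forall i, atm_le (lo e) i a == S (lo e) i]].
  have [a aN [ah al]] := @N_exists e (S (hi e) false) (S (lo e)) (cl e).
  by exists a; rewrite aN ah eqxx; apply/forallP => i; rewrite al.
have gN e : xchoose (ex e) \in Nelts e by case/andP: (xchooseP (ex e)).
have gE e p i : atm_le p i (xchoose (ex e)) = (Atm p i \in Nset (hi e) (lo e)) && S p i.
  case: (boolP (Atm p i \in _)) => [pN|]; last by apply: contraNF; apply: atm_leN.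
  move/and3P: (xchooseP (ex e)) => [_ /eqP h /forallP l].
  move: pN; rewrite NsetE => /orP[/eqP->|/andP[/eqP->]]; first exact/eqP.
  by case: i.
have cmp : compatible (mk_vec gN).
  apply/compatibleP => e f; rewrite !mk_vecE; apply: chopped_atm_eq => p i.
  rewrite !atm_leI !gE /atm_le !val_top.
  have leT g : name_le (Atm p i) (Top (hi g) (lo g)) =
    (Atm p i \in Nset (hi g) (lo g)) by rewrite NsetE.
  by rewrite !leT [LHS]andbAC [RHS]andbAC; congr (_ && _); rewrite andbC.
exists (IdM cmp) => e; rewrite !mk_vecE gE Nset_hi; split=> // i.
by rewrite gE Nset_lo.
Qed.

End Atoms.

(** * The 1960 complement and its atoms *)

Section Complement.
Set Implicit Arguments.
Unset Strict Implicit.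
Unset Printing Implicit Defensive.
Context {d : Order.disp_t} {P : finPOrderType d}.
Variables u v : idM P.
Hypothesis uv : u <= v.
Implicit Types (a b : chopped P) (e f : cpair P) (p : P) (i j : bool).
Implicit Types (w : idM P) (c : vec P).

Definition diff_at p i : bool := at_in v p i && ~~ at_in u p i.

Lemma diff_atE p i : (elt (Atm p i) \in At v :\: At u) = diff_at p i.
Proof. by rewrite inE andbC. Qed.

Lemma splitsP p i : diff_at p i ->
  reflect (exists e, [/\ lo e = p, diff_at (hi e) false & at_in u p (~~ i)])
          (splits u v p).
Proof.
move=> Dpi; apply: (iffP existsP) => [[j /existsP[e /and4P[/eqP ep]]]|[e [ep De Up]]].
  rewrite !diff_atE => De Dj Uj; exists e; split=> //.
  (* The index in the definition of splitting is forced: the other atom of [p] lies in [u], while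
     [p_i] does not. *)
  suff <- : j = i by [].
  have [//|ji] := eqVneq j i; have /andP[_ nU] := Dpi.
  have ie : i = ~~ j by move: ji; case: (i); case: (j).
  by move: nU; rewrite ie [at_in _ _ _]Uj.
by exists i; apply/existsP; exists e; rewrite ep eqxx !diff_atE De Dpi.
Qed.

Lemma mem_Split p i : diff_at p i ->
  (elt (Atm p i) \in Defs.Split u v) = splits u v p.
Proof.
move=> Dpi; rewrite inE diff_atE Dpi /=.
(* Outside [M] the map [elt] collapses names to [0]; membership in [At v] places both names in [M],
   where [elt] is injective. *)
have pM q j : at_in v q j -> in_chopped (Atm q j).
  by rewrite /at_in inE => /andP[/atom_chopped].
apply/existsP/idP => [[q /andP[spq /existsP[j /eqP eq]]]|spq]; last first.
  by exists p; rewrite spq; apply/existsP; exists i.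
have vp : at_in v p i by case/andP: Dpi.
have vq : at_in v q j by rewrite /at_in -eq.
move/(congr1 val): eq; rewrite /elt !val_insubd !pM // => -[-> _].
exact: spq.
Qed.

Definition s_at p i : bool := diff_at p i && ~~ splits u v p.

Lemma s_atE p i : (elt (Atm p i) \in (At v :\: At u) :\: Defs.Split u v) = s_at p i.
Proof.
rewrite in_setD diff_atE /s_at andbC; case Dpi: (diff_at p i) => //=.
by rewrite mem_Split.
Qed.

(** By closure of [v] the other atom of [lo e] is in [v]. Were it in [u] as well, [e] would witness
    that [lo e] splits. *)
Lemma s_at_closed e i j : s_at (hi e) false -> s_at (lo e) i -> s_at (lo e) j.
Proof.
move=> /andP[Dp _] /andP[Dq nsq].
have [->|ij] := eqVneq j i; first by rewrite /s_at Dq.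
have -> : j = ~~ i by move: ij; case: (i); case: (j).
rewrite /s_at nsq andbT /diff_at.
have /andP[vp _] := Dp; have /andP[vq _] := Dq.
rewrite (at_in_closed _ vp vq); apply: contra nsq => uq.
by apply/(splitsP Dq); exists e.
Qed.

Lemma s1960_at e : atm_le (hi e) false (s1960 u v e) = s_at (hi e) false /\
  forall i, atm_le (lo e) i (s1960 u v e) = s_at (lo e) i.
Proof.
(* The set is closed, so it is the atom set of a compatible vector [w], which is then compared with
   the join in both directions. *)
have [w wE] := idM_exists s_at_closed.
suff -> : s1960 u v = w by apply: wE.
have atw f p i : Atm p i \in Nset (hi f) (lo f) -> at_in w p i = s_at p i.
  move=> pN; rewrite (at_inE _ pN); move: pN; have [wh wl] := wE f.
  rewrite NsetE => /orP[/eqP->|/andP[/eqP->]]; first exact: wl.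
  by case: i.
have atA f p i : Atm p i \in Nset (hi f) (lo f) ->
    atom_idM (elt (Atm p i)) = atom_vec (elt (Atm p i)) :> vec P.
  by move=> /atom_elt /atom_idM_vec.
apply/le_anti/andP; split.
  apply/joinsP => a;
    have [/existsP[f /existsP[p /existsP[i /andP[pN /eqP->]]]]|no] :=
    boolP [exists f : cpair P, exists p, exists i,
       (Atm p i \in Nset (hi f) (lo f)) && (a == elt (Atm p i))].
    rewrite s_atE => sp.
    have := sp; rewrite -(atw f) // /at_in inE => /andP[_].
    by move=> H; apply/idM_leP => g; move/vec_leP/(_ g): H; rewrite (atA f).
  move=> aS; case/negP: no.
  have : a \in At v by move: aS; rewrite !inE => /andP[_ /andP[_]].
  rewrite inE => /andP[aat _].
  case/orP: (valP a) => [/eqP a0|/existsP[f af]].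
    have a_bot : a = \bot by apply: val_inj.
    by move: aat; rewrite a_bot /atom /covers ltxx.
  have vale : elt (val a) = a by rewrite /elt valKd.
  (* Some named [p_i] lies below [a]; since [a] covers [0], the two are equal, against [no]. *)
  have [p [i [pN pa]]] : exists p i, Atm p i \in Nset (hi f) (lo f) /\ atm_le p i a.
    move: af; rewrite NsetE.
    have a0 : val a <> Zero.
      move=> a0; have a_bot : a = \bot by apply: val_inj.
      by move: aat; rewrite a_bot /atom /covers ltxx.
    rewrite /atm_le; case E: (val a) a0 => [|x j|x|x y] // _.
    - by exists x, j; rewrite NsetE /= !eqxx.
    - by move=> /eqP->; exists (lo f), false; rewrite NsetE /= !eqxx.
    - by move=> /andP[/eqP-> /eqP->]; exists (lo f), false; rewrite NsetE /= !eqxx.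
  apply/existsP; exists f; apply/existsP; exists p; apply/existsP; exists i.
  rewrite pN /=; case/andP: aat => _ /forallP/(_ (elt (Atm p i))).
  apply: contraR => ne; rewrite [_ < a]lt_neqAle
    eq_sym ne leE_name (val_elt pN) [name_le _ _]pa.
  by rewrite (andP (atom_elt pN)).1.
have le p i : s_at p i -> at_in (s1960 u v) p i.
  rewrite -s_atE => sp.
  have pat : atom (elt (Atm p i) : chopped P).
    by move: sp; rewrite !inE => /and3P[_ _ /andP[]].
  have := @joins_sup _ _ _ (elt (Atm p i))
    (fun a => a \in (At v :\: At u) :\: Defs.Split u v) (@atom_idM _ P) sp.
  move=> le; rewrite /at_in inE pat.
  by rewrite -(atom_idM_vec pat); exact: le.
apply/idM_le_at => p i wp; apply: le.
by have [f pN] := at_inN wp; rewrite -(atw f).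
Qed.

Lemma at_in_s1960 p i : at_in (s1960 u v) p i = s_at p i.
Proof.
apply/idP/idP => [sp|sp].
  have [e pN] := at_inN sp; move: sp; rewrite (at_inE _ pN); have [sh sl] := s1960_at e.
  move: pN; rewrite NsetE => /orP[/eqP->|/andP[/eqP->]]; first by rewrite sl.
  by case: i; rewrite // sh.
have [e pN] : exists e : cpair P, Atm p i \in Nset (hi e) (lo e).
  by case/andP: sp => /andP[/at_inN].
rewrite (at_inE _ pN); have [sh sl] := s1960_at e.
move: pN; rewrite NsetE => /orP[/eqP pE|/andP[/eqP pE]]; first by rewrite pE sl -pE.
by case: i sp => // sp _; rewrite pE sh -pE.
Qed.

Lemma s1960_complement : sectional_complement u v (s1960 u v).
Proof.
split.
  apply: idM_eq_at => p i; rewrite at_inI at_in_s1960 /s_at /diff_at.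
  have -> : at_in (\bot : idM P) p i = false.
    apply/negP => b; have [e pN] := at_inN b; move: b.
    by rewrite (at_inE _ pN) mk_vecE.
  by case: (at_in u p i); rewrite ?andbF.
apply/le_anti/andP; split.
  rewrite leUx uv; apply/idM_le_at => p i.
  by rewrite at_in_s1960 => /andP[/andP[]].
set w := u `|` s1960 u v.
have uw : forall p i, at_in u p i -> at_in w p i by apply/idM_le_at/leUl.
have sw : forall p i, s_at p i -> at_in w p i.
  by move=> p i; rewrite -at_in_s1960; move: p i; apply/idM_le_at/leUr.
apply/idM_le_at => p.
(* Induction on the number of elements strictly above [p], so that a witness covering [p] is handled
   first. *)
have [n] := ubnP #|[set x : P | p < x]|; elim: n p => // n IH p pn i vp.
have [/uw//|nu] := boolP (at_in u p i).
have Dp : diff_at p i by rewrite /diff_at vp.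
have [/(splitsP Dp)[e [ep /andP[vq _] up]]|nsp] := boolP (splits u v p); last first.
  by apply: sw; rewrite /s_at Dp.
(* The witness atom and the other atom of [p], which lies in [u], together generate [p_i]. *)
rewrite -ep; apply: (@at_in_closed _ _ w e (~~ i)); last by rewrite ep; apply: uw.
apply: IH => //; rewrite ltnS in pn; apply: leq_trans pn; apply: proper_card.
rewrite -ep; apply/properP; split.
  by apply/subsetP => x; rewrite !inE; apply: lt_trans; apply: cpair_lt.
by exists (hi e); rewrite !inE ?ltxx // cpair_lt.
Qed.


(** * Atoms of the maximal complement [m] and witnesses of splitting *)

Lemma m_at e :
  atm_le (hi e) false (m_vec u v e) = diff_at (hi e) false /\
  forall i, atm_le (lo e) i (m_vec u v e) =
    diff_at (lo e) i && ~~ (diff_at (hi e) false && at_in u (lo e) (~~ i)).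
Proof.
have [/and3P[sN /eqP us0 /and4P[_ _ sv _]] smax] := m_vecP e uv.
set s := m_vec u v e in sN us0 sv smax *.
have dis p i : atm_le p i (u e) -> atm_le p i s = false.
  by move=> up; have := atm_le0 p i; rewrite -us0 atm_leI up.
(* The element [x] has exactly the claimed atoms. It is a sectional complement in [N(p,q)], so it
   lies below the largest one, [s]. *)
have [|x xN [xh xl]] := @N_exists _ _ e (diff_at (hi e) false)
    (fun i => diff_at (lo e) i && ~~ (diff_at (hi e) false && at_in u (lo e) (~~ i))).
  move=> i j Dh; rewrite Dh /= => /andP[Dl nU].
  have [->|ij] := eqVneq j i; first by rewrite Dl.
  have -> : j = ~~ i by move: ij; case: (i); case: (j).
  have /andP[vh _] := Dh; have /andP[vl nu] := Dl.
  by rewrite negbK /diff_at nU nu (at_in_closed _ vh vl).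
have xs : x <= s.
  apply: smax; apply/and3P; split=> //.
    apply/eqP/(@N_eq _ _ e); rewrite ?mem_N0 ?vec_meet_N //.
    - by rewrite mem_N leIxl // -mem_N vecN.
    - by rewrite atm_leI xh /diff_at (at_in_hi u); case: (atm_le _ _ (u e)); rewrite ?andbF.
    - by move=> i; rewrite atm_leI xl /diff_at (at_in_lo u e i);
        case: (atm_le (lo e) i (u e)); rewrite ?andbF.
  apply/and4P; split; first exact: vecN.
  - exact: (idM_leP _ _ uv).
  - apply: (N_le xN); first by rewrite xh /diff_at at_in_hi => /andP[].
    by move=> i; rewrite xl /diff_at at_in_lo => /andP[/andP[]].
  apply/forallP => c; apply/implyP => cN; apply/implyP => /andP[uc xc].
  have ch : at_in v (hi e) false -> atm_le (hi e) false c.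
    move=> vh; have [uh|nuh] := boolP (at_in u (hi e) false).
      by apply: atm_le_trans uc _; rewrite -at_in_hi.
    by apply: atm_le_trans xc _; rewrite xh /diff_at vh.
  apply: (@N_le _ _ e); first exact: vecN.
    by rewrite -at_in_hi.
  move=> i; rewrite -at_in_lo => vi.
  have [ui|nui] := boolP (at_in u (lo e) i).
    by apply: atm_le_trans uc _; rewrite -at_in_lo.
  have [/andP[/andP[vh _] un]|ok] := boolP (diff_at (hi e) false && at_in u (lo e) (~~ i)).
    by rewrite at_in_lo in un; apply: N_closed cN (ch vh) (atm_le_trans uc un).
  by apply: atm_le_trans xc _; rewrite xl ok /diff_at vi nui.
have sD p i : Atm p i \in Nset (hi e) (lo e) -> atm_le p i s -> diff_at p i.
  move=> pN ps; rewrite /diff_at !(at_inE _ pN) (atm_le_trans sv ps) /=.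
  by apply: contraTN ps => /dis->.
split.
  apply/idP/idP => [|Dh]; first exact/sD/Nset_hi.
  by apply: atm_le_trans xs _; rewrite xh.
(* If [p_1] is in the difference, it is below [s]; a [q_i] below [s] would then bring in the other
   atom of [q], which cannot lie in [u]. *)
move=> i; apply/idP/idP => [si|Di]; last by apply: atm_le_trans xs _; rewrite xl.
rewrite (sD _ _ (Nset_lo e i) si) /=; apply/negP => /andP[Dh].
rewrite at_in_lo => /dis; rewrite (N_closed _ sN _ si) //.
by apply: atm_le_trans xs _; rewrite xh.
Qed.

Lemma m_hi e : atm_le (hi e) false (m_vec u v e) = diff_at (hi e) false.
Proof. exact: (m_at e).1. Qed.

Lemma m_lo e i : atm_le (lo e) i (m_vec u v e) =
  diff_at (lo e) i && ~~ (diff_at (hi e) false && at_in u (lo e) (~~ i)).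
Proof. exact: (m_at e).2. Qed.

Definition split_witness e i : bool :=
  [&& diff_at (hi e) false, diff_at (lo e) i & at_in u (lo e) (~~ i)].

Lemma split_witnessP e i : diff_at (lo e) i ->
  reflect (exists2 f, lo f = lo e & split_witness f i) (splits u v (lo e)).
Proof.
move=> De; apply: (iffP (splitsP De)) => [[f [fe Df uf]]|[f fe /and3P[Df _ uf]]].
  by exists f; rewrite // /split_witness fe Df De.
by exists f; rewrite -fe.
Qed.

(** One lower atom is dropped by the formula for [m] and the other lies in [u]. Hence V-cuts never
    touch a witness edge. *)
Lemma split_witness_m e i j : split_witness e i ->
  atm_le (lo e) j (m_vec u v e) = false.
Proof.
case/and3P=> Dh Dl nu; rewrite m_lo Dh /=.
have [->|ij] := eqVneq j i; first by rewrite nu andbF.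
have -> : j = ~~ i by move: ij; case: (i); case: (j).
by rewrite /diff_at nu andbF.
Qed.

(** An edge that keeps a lower atom is not a witness itself; as the other atom is in [u], the upper
    atom must be missing from the difference. So [m] is this single atom here, the shape that a
    V-cut requires. *)
Lemma split_m e i : splits u v (lo e) -> atm_le (lo e) i (m_vec u v e) ->
  diff_at (hi e) false = false /\ atm_le (lo e) (~~ i) (m_vec u v e) = false.
Proof.
rewrite m_lo => spl /andP[De nw].
have /(split_witnessP De)[f fe /and3P[Df _ uf]] := spl.
rewrite fe in uf; rewrite uf andbT in nw; rewrite (negPf nw).
by rewrite m_lo /diff_at uf !andbF.
Qed.

(** * Failures in terms of atoms, and existence of the cuts *)

Lemma V_incompatibleP c e f :
  reflect (exists i, atm_le (lo e) i (c e) != atm_le (lo e) i (c f))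
    (V_incompatible c e f).
Proof.
have leE p i : atm_le p i (elt (Elt (lo e))) = (p == lo e).
  by rewrite /atm_le (@val_elt _ _ e) ?NsetE.
apply: (iffP idP) => [inc|[i neq]].
  apply/existsP; apply: contraR inc; rewrite negb_exists => /forallP H.
  apply/eqP/chopped_atm_eq => p i; rewrite !atm_leI !leE.
  by have [->|] := eqVneq p (lo e); rewrite ?andbF // !andbT; apply/eqP/negPn/H.
apply: contra neq => /eqP /(congr1 (atm_le (lo e) i)).
by rewrite !atm_leI !leE eqxx !andbT => ->.
Qed.

Lemma C_incompatibleE c e f : lo e = hi f ->
  C_incompatible c e f = (atm_le (lo e) false (c e) != atm_le (hi f) false (c f)).
Proof.
move=> ef; have leE p i : atm_le p i (elt (Atm (hi f) false)) =
    (p == hi f) && (i == false).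
  by rewrite /atm_le (@val_elt _ _ f) ?Nset_hi.
congr (~~ _); apply/eqP/eqP => [/(congr1 (atm_le (hi f) false))|H].
  by rewrite !atm_leI !leE !eqxx !andbT ef.
apply: chopped_atm_eq => p i; rewrite !atm_leI !leE.
have [->|] := eqVneq p (hi f); rewrite ?andbF //.
by have [->|] := eqVneq i false; rewrite ?andbF // !andbT -{1}ef.
Qed.

Lemma eq_elt_lo e i a : a \in Nelts e -> atm_le (hi e) false a = false ->
  atm_le (lo e) i a -> atm_le (lo e) (~~ i) a = false -> a = elt (Atm (lo e) i).
Proof.
move=> aN ah al anl; have vE := @val_elt _ _ e _ (Nset_lo e i).
apply: (N_eq aN); first by rewrite inE vE Nset_lo.
  by rewrite ah /atm_le vE /= hi_neq_lo.
move=> j; rewrite {2}/atm_le vE /= eqxx /=.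
have [->|ji] := eqVneq j i; first by rewrite al.
by have -> : j = ~~ i by move: ji; case: (i); case: (j).
Qed.

Lemma eq_elt_hi e a : a \in Nelts e -> atm_le (hi e) false a ->
  (forall i, atm_le (lo e) i a = false) -> a = elt (Atm (hi e) false).
Proof.
move=> aN ah al; have vE := @val_elt _ _ e _ (Nset_hi e).
apply: (N_eq aN); first by rewrite inE vE Nset_hi.
  by rewrite ah /atm_le vE /= eqxx.
by move=> j; rewrite al /atm_le vE /= lo_neq_hi.
Qed.

Lemma eq_top e i a : a \in Nelts e -> atm_le (hi e) false a ->
  atm_le (lo e) i a -> a = top e.
Proof.
move=> aN ah al; apply: (N_eq aN (top_N e)).
  by rewrite ah /atm_le val_top /= eqxx orbT.
by move=> j; rewrite (N_closed _ aN ah al) /atm_le val_top /= eqxx.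
Qed.

Lemma is_update_exists c e a : a \in Nelts e -> exists c', is_update c e a c'.
Proof.
move=> aN; have gN g : (if g == e then a else c g) \in Nelts g.
  by case: eqP => [->|_] //; apply: vecN.
by exists (mk_vec gN); apply/forallP => g; rewrite mk_vecE.
Qed.

Lemma is_update_eq c e a c' : is_update c e a c' -> c' e = a.
Proof. by move/forallP/(_ e)/eqP->; rewrite eqxx. Qed.

Lemma is_update_neq c e a c' g : is_update c e a c' -> g != e -> c' g = c g.
Proof. by move=> /forallP/(_ g)/eqP-> /negPf->. Qed.

(** The termination measure: each cut moves one component away from its value in [m], and no cut
    restores one. *)
Definition uncut c : {set cpair P} := [set e | c e == m_vec u v e].

Lemma uncut_update c e a c' : is_update c e a c' -> c e = m_vec u v e ->
  a != m_vec u v e -> (#|uncut c'| < #|uncut c|)%N.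
Proof.
move=> up ce am; apply/proper_card/properP; split.
  apply/subsetP => g; rewrite !inE; have [->|ge] := eqVneq g e.
    by rewrite (is_update_eq up) (negPf am).
  by rewrite (is_update_neq up ge).
by exists e; rewrite inE ?ce // (is_update_eq up).
Qed.

Lemma V_failureC c e f : V_failure (m_vec u v) c e f -> V_failure (m_vec u v) c f e.
Proof.
case/and4P=> /andP[hef lef] /V_incompatibleP[i neq] ce cf.
rewrite /V_failure /V_suborder eq_sym hef eq_sym lef ce cf /= andbT.
by apply/V_incompatibleP; exists i; rewrite -(eqP lef) eq_sym.
Qed.

Lemma V_cut_exists c e f : V_failure (m_vec u v) c e f ->
  exists2 c', V_cut (m_vec u v) c c' & (#|uncut c'| < #|uncut c|)%N.
Proof.
move=> fail; have /and4P[_ /V_incompatibleP[i neq] _ _] := fail.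
(* The two components disagree on the atom with index [i]; by symmetry [e] is the edge that has
   it. *)
wlog el : e f fail neq / atm_le (lo e) i (m_vec u v e).
  move=> IH; have := fail; case/and4P=> /andP[_ /eqP lef] _ /eqP ce /eqP cf.
  have [|nel] := boolP (atm_le (lo e) i (m_vec u v e)); first exact: (IH e f).
  apply: (IH f e (V_failureC fail)); rewrite -lef; first by rewrite eq_sym.
  by move: neq; rewrite ce cf (negPf nel); case: atm_le.
have /and4P[/andP[hef /eqP lef] _ /eqP ce /eqP cf] := fail.
have De : diff_at (lo e) i by move: el; rewrite m_lo => /andP[].
(* The atom is in the difference but absent from [m] at [f], which happens only when [f] is a
   witness. *)
have wf : split_witness f i.
  move: neq; rewrite ce cf el {1}lef m_lo -lef De /= negbK => /andP[Df uf].
  by rewrite /split_witness Df -lef De uf.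
have se : splits u v (lo e) by apply/(split_witnessP De); exists f.
have [Dh nl] := split_m se el.
have me : m_vec u v e = elt (Atm (lo e) i).
  by apply: eq_elt_lo => //; [apply: vecN | rewrite m_hi].
have mf : m_vec u v f = elt (Atm (hi f) false).
  apply: eq_elt_hi; first exact: vecN.
    by rewrite m_hi; case/and3P: wf.
  by move=> j; apply: split_witness_m wf.
have [c' up] := is_update_exists c (mem_N0 e); exists c'; last first.
  apply: uncut_update up ce _; apply/eqP => m0.
  by move: el; rewrite -m0.
apply/existsP; exists e; apply/existsP; exists f; apply/existsP; exists i.
by rewrite fail me mf up !eqxx.
Qed.

(** Whether [q_1] is in the difference decides its presence in [m] at [f]; at [e] only the witness
    condition can alter the answer. *)
Lemma C_failure_dec c e f : C_failure (m_vec u v) c e f ->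
  [/\ split_witness e false, lo e = hi f & diff_at (hi f) false].
Proof.
case/and4P=> /eqP ef; rewrite (C_incompatibleE _ ef) => inc /eqP ce /eqP cf.
move: inc; rewrite ce cf m_hi m_lo /split_witness ef.
by do 2 case: (diff_at _ false) => //=; case: (at_in u _ _).
Qed.

Lemma C_minimal_exists c e f : C_failure (m_vec u v) c e f ->
  exists e' f', C_minimal_failure (m_vec u v) c e' f'.
Proof.
have [n] := ubnP #|[set x : P | x < hi f]|; elim: n e f => // n IH e f fn fail.
have [min|] := boolP [forall e', forall f',
    C_failure (m_vec u v) c e' f' ==> ~~ (hi f' < hi f)].
  by exists e, f; apply/andP.
rewrite negb_forall => /existsP[e']; rewrite negb_forall => /existsP[f'].
rewrite negb_imply negbK => /andP[fail' lt]; apply: IH fail'.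
rewrite ltnS in fn; apply: leq_trans fn; apply/proper_card/properP; split.
  by apply/subsetP => x; rewrite !inE => /lt_trans; apply.
by exists (hi f'); rewrite !inE ?ltxx.
Qed.

Lemma C_cut_exists c e f : C_failure (m_vec u v) c e f ->
  exists2 c', C_cut (m_vec u v) c c' & (#|uncut c'| < #|uncut c|)%N.
Proof.
case/C_minimal_exists => {e f} e [f min]; have /andP[fail _] := min.
have [_ _ Df] := C_failure_dec fail; have /and4P[_ _ _ /eqP cf] := fail.
have mh : atm_le (hi f) false (m_vec u v f) by rewrite m_hi.
(* Both prescribed values lack the upper atom, which [m] has at [f]; so the component really
   changes. *)
suff [a aN [cond ah]] : exists2 a, a \in Nelts f &
    (forall c', is_update c f a c' ->
      (m_vec u v f == elt (Atm (hi f) false)) && is_update c f \bot c'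
      || (m_vec u v f == top f) && is_update c f (elt (Elt (lo f))) c')
    /\ atm_le (hi f) false a = false.
  have [c' up] := is_update_exists c aN; exists c'.
    apply/existsP; exists e; apply/existsP; exists f.
    by rewrite min cond.
  by apply: uncut_update up cf _; apply: contraFN ah => /eqP->.
(* With a lower atom present [m] is [q(r)] at [f], and the cut leaves [r]; otherwise [m] is [q_1],
   and the cut leaves [0]. *)
have [/existsP[i li]|] := boolP [exists i, atm_le (lo f) i (m_vec u v f)].
  have EN : Elt (lo f) \in Nset (hi f) (lo f) by rewrite NsetE eqxx.
  exists (elt (Elt (lo f))); first by rewrite inE (val_elt EN).
  split=> [c' ->|]; last by rewrite /atm_le (val_elt EN) /= hi_neq_lo.
  by rewrite (eq_top (vecN _ f) mh li) eqxx orbT.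
rewrite negb_exists => /forallP none; exists \bot; first exact: mem_N0.
split=> // c' ->; rewrite (eq_elt_hi (vecN _ f) mh) ?eqxx // => i.
exact/negbTE.
Qed.

(** * Invariants of the two cutting phases *)

Definition V_invariant c := forall e, c e = m_vec u v e \/
  [/\ c e = \bot, splits u v (lo e) & exists i, atm_le (lo e) i (m_vec u v e)].

(** The partner edge of a V-cut lacks an atom of the difference, so it witnesses that [lo e]
    splits. *)
Lemma V_cut_invariant c c' : V_cut (m_vec u v) c c' -> V_invariant c -> V_invariant c'.
Proof.
case/existsP=> e /existsP[f /existsP[i /and4P[fail /eqP me /eqP mf up]]] inv g.
have [->|ge] := eqVneq g e; last by rewrite (is_update_neq up ge); apply: inv.
have /and4P[/andP[_ /eqP lef] _ _ _] := fail.
have le_ : atm_le (lo e) i (m_vec u v e).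
  by rewrite me /atm_le (val_elt (Nset_lo e i)) /= !eqxx.
right; rewrite (is_update_eq up); split=> //; last by exists i.
have De : diff_at (lo e) i by move: le_; rewrite m_lo => /andP[].
apply/(split_witnessP De); exists f => //.
have : atm_le (lo f) i (m_vec u v f) = false.
  by rewrite mf /atm_le (val_elt (Nset_hi f)) /= lo_neq_hi.
by rewrite m_lo /split_witness -lef De /= => /negbFE.
Qed.

(** A lower atom of a splitting element that survived at [e] would clash with a witness edge, which
    is still uncut, and give a V-failure. *)
Lemma V_invariant_final c : V_invariant c ->
  (forall e f, ~~ V_failure (m_vec u v) c e f) -> forall e,
  atm_le (hi e) false (c e) = diff_at (hi e) false /\
  forall i, atm_le (lo e) i (c e) = diff_at (lo e) i && ~~ splits u v (lo e).
Proof.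
move=> inv nofail e.
have [ce|[ce se [i mi]]] := inv e; last first.
  (* Cutting to [0] loses no upper atom, since there is none in the difference at such an edge. *)
  by rewrite ce se; have [-> _] := split_m se mi; split=> // j; rewrite andbF.
rewrite ce m_hi; split=> // i; have [se|nse] := boolP (splits u v (lo e)).
  rewrite andbF; apply/negP => mi; move: (mi); rewrite m_lo => /andP[De _].
  have /(split_witnessP De)[f fe wf] := se.
  have cf : c f = m_vec u v f.
    by have [//|[_ _ [j]]] := inv f; rewrite (split_witness_m _ wf).
  have /negP := nofail e f; apply; rewrite /V_failure ce cf !eqxx !andbT.
  rewrite /V_suborder -fe eqxx andbT; apply/andP; split.
    (* Equal upper ends would identify [e] with the witness [f], whose component in [m] has no lower
       atoms. *)
    apply/eqP => hef; have ef : e = f.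
      apply/val_inj; move: hef fe; rewrite /hi /lo.
      by case: (val e) (val f) => ? ? [? ?] /= -> ->.
    by move: mi; rewrite ef (split_witness_m _ wf).
  apply/V_incompatibleP; exists i; rewrite ce cf mi.
  by rewrite -fe (split_witness_m _ wf).
rewrite m_lo andbT; have [De|//] := boolP (diff_at (lo e) i).
rewrite /=; apply: contra nse => /andP[Dh ul].
by apply/(split_witnessP De); exists e; rewrite // /split_witness Dh De.
Qed.

(* The second alternative says that the lower edge e may still be cut: no upper
   edge f that exhibits a splitting of hi e has been cut yet.  Cutting only
   minimal failures is what preserves it. *)
Definition C_invariant c := forall e,
  (forall i, atm_le (lo e) i (c e) = s_at (lo e) i) /\
  (atm_le (hi e) false (c e) = s_at (hi e) false \/
   atm_le (hi e) false (c e) = diff_at (hi e) false /\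
   forall f, lo f = hi e -> split_witness f false -> c f = m_vec u v f).

Lemma C_invariant_failure c e f : C_invariant c -> lo e = hi f ->
  split_witness e false -> c e = m_vec u v e ->
  atm_le (hi f) false (c f) = diff_at (hi f) false ->
  C_failure (m_vec u v) c e f.
Proof.
move=> inv ef we ce hf; have /and3P[_ Df _] := we; rewrite ef in Df.
have cf : c f = m_vec u v f.
  (* With the upper atom of [f] in the difference, [m] drops a lower atom of the difference at [f]
     exactly when [lo f] splits, which agrees with [s_at]. *)
  apply: (N_eq (vecN _ f) (vecN _ f)); rewrite ?m_hi // => i.
  have [-> _] := inv f; apply/idP/idP => [/andP[De]|mi].
    rewrite m_lo De; apply: contra => /andP[_ ul].
    by apply/(split_witnessP De); exists f; rewrite // /split_witness Df De.
  have := mi; rewrite m_lo /s_at => /andP[-> _]; apply/negP => sf.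
  by have [] := split_m sf mi; rewrite Df.
rewrite /C_failure /C_suborder ef eqxx (C_incompatibleE _ ef) ce cf !eqxx !andbT.
by rewrite (split_witness_m _ we) m_hi Df.
Qed.

Lemma C_cut_invariant c c' :
  C_cut (m_vec u v) c c' -> C_invariant c -> C_invariant c'.
Proof.
case/existsP=> e /existsP[f /andP[/andP[fail /forallP min] up]] inv.
have [we ef Df] := C_failure_dec fail; have /and4P[_ _ _ /eqP cf] := fail.
(* Either form of the cut removes the upper atom alone. *)
have [a [up' ah al]] : exists a, [/\ is_update c f a c',
    atm_le (hi f) false a = false &
    forall i, atm_le (lo f) i a = atm_le (lo f) i (c f)].
  case/orP: up => /andP[/eqP mf up].
    exists \bot; split=> // i; rewrite cf mf /atm_le (val_elt (Nset_hi f)) /=.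
    by rewrite lo_neq_hi.
  have EN : Elt (lo f) \in Nset (hi f) (lo f) by rewrite NsetE eqxx.
  exists (elt (Elt (lo f))); split=> //.
    by rewrite /atm_le (val_elt EN) /= hi_neq_lo.
  by move=> i; rewrite cf mf /atm_le (val_elt EN) val_top /= eqxx.
move=> g; have [gl gh] := inv g; have [gf|gf] := eqVneq g f.
  rewrite gf (is_update_eq up'); split=> [i|]; first by rewrite al -gf gl.
  left; rewrite ah /s_at Df; apply/esym/negbF/(splitsP Df).
  by have /and3P[De _ ue] := we; exists e; rewrite -ef.
rewrite (is_update_neq up' gf); split=> //; case: gh => [|[gh unc]]; first by left.
have [Dg|nDg] := boolP (diff_at (hi g) false); last first.
  by left; rewrite gh /s_at (negPf nDg).
right; rewrite gh Dg; split=> // f0 f0g wf0; have cf0 := unc f0 f0g wf0.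
have [f0f|f0f] := eqVneq f0 f; last by rewrite (is_update_neq up' f0f).
rewrite f0f in f0g wf0 cf0.
(* Were the edge being cut a witness for [hi g], then [f] and [g] would already form a failure at
   [hi g < hi f], against minimality. *)
have failg := C_invariant_failure inv f0g wf0 cf0 gh.
have /forallP/(_ g) := min f; rewrite failg /= -f0g.
by rewrite cpair_lt.
Qed.

(** An upper atom that should have been removed has an uncut witness edge above it, and the pair
    would still be a C-failure. *)
Lemma C_invariant_final c : C_invariant c ->
  (forall e f, ~~ C_failure (m_vec u v) c e f) -> c = s1960 u v.
Proof.
move=> inv nofail; apply: vecP => e; have [sh sl] := s1960_at e.
have [cl ch] := inv e.
apply: (N_eq (vecN _ e) (vecN _ e)) => [|i]; last by rewrite cl sl.
rewrite sh; case: ch => // [[ch unc]]; rewrite ch /s_at.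
have [De|//] := boolP (diff_at (hi e) false).
apply/esym/negP => /(splitsP De)[f [fe Df uf]].
have wf : split_witness f false by rewrite /split_witness fe Df De.
have /negP := nofail f e; apply.
by apply: C_invariant_failure inv fe wf (unc f fe wf) _; rewrite ch De.
Qed.

(** * Runs of the algorithm: termination, and independence of choices *)

Lemma connect_normal (T : finType) (R : rel T) (mu : T -> nat) (stop : pred T) :
  (forall x, ~~ stop x -> exists2 y, R x y & (mu y < mu x)%N) ->
  forall x, exists2 y, connect R x y & stop y.
Proof.
move=> step x; have [n] := ubnP (mu x); elim: n x => // n IH x xn.
have [sx|/step[y xy yx]] := boolP (stop x); first by exists x.
have [|z yz sz] := IH y; first exact: leq_trans yx xn.
by exists z => //; apply: connect_trans yz; apply: connect1.
Qed.

Lemma connect_invariant (T : finType) (R : rel T) (I : T -> Prop) :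
  (forall x y, R x y -> I x -> I y) -> forall x y, connect R x y -> I x -> I y.
Proof.
move=> step x y /connectP[s + ->]; elim: s x => //= z s IH x /andP[xz zs] Ix.
exact: IH zs (step _ _ xz Ix).
Qed.

Lemma algorithm_output_s1960 c : algorithm_output u v c -> c = s1960 u v.
Proof.
case/existsP=> b /and4P[mb /forallP noV bc /forallP noC].
have invV : V_invariant b.
  by apply: connect_invariant V_cut_invariant _ _ mb _ => e; left.
have bE := V_invariant_final invV (fun e => forallP (noV e)).
apply: C_invariant_final (fun e => forallP (noC e)).
apply: connect_invariant C_cut_invariant _ _ bc _ => e; have [bh bl] := bE e.
(* After the V-phase every witness edge is uncut, so the second alternative of the C-invariant holds
   everywhere at the start. *)
split=> //; right; split=> // f fe wf.
have [//|[_ _ [i]]] := invV f; by rewrite (split_witness_m _ wf).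
Qed.

Lemma algorithm_output_exists : exists c, algorithm_output u v c.
Proof.
have [|b mb noV] := @connect_normal _ (V_cut (m_vec u v)) (fun c => #|uncut c|)
  (fun c => [forall e, forall f, ~~ V_failure (m_vec u v) c e f]) _ (m_vec u v).
  move=> x; rewrite negb_forall => /existsP[e]; rewrite negb_forall.
  by case/existsP=> f; rewrite negbK; apply: V_cut_exists.
have [|c bc noC] := @connect_normal _ (C_cut (m_vec u v)) (fun c => #|uncut c|)
  (fun c => [forall e, forall f, ~~ C_failure (m_vec u v) c e f]) _ b.
  move=> x; rewrite negb_forall => /existsP[e]; rewrite negb_forall.
  by case/existsP=> f; rewrite negbK; apply: C_cut_exists.
by exists c; apply/existsP; exists b; apply/and4P.
Qed.

End Complement.

Theorem theorem3 (d : Order.disp_t) (P : finPOrderType d) (u v : idM P) :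
  u <= v ->
  exists s : idM P,
    [/\ forall c : vec P, algorithm_output u v c <-> c = s,
        sectional_complement u v s
      & s = s1960 u v].
Proof.
move=> uv; exists (s1960 u v); split=> //; last exact: s1960_complement.
move=> c; split=> [|->]; first exact: algorithm_output_s1960.
(* Every output equals [s1960 u v]; that this vector is itself an output follows once some run is
   known to end. *)
have [b bout] := algorithm_output_exists uv.
by rewrite -(algorithm_output_s1960 uv bout).
Qed.
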